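(* Let $A\in\mathbb{R}^{n\times n}$, $B\in\mathbb{R}^{n\times m}$, $C\in\mathbb{R}^{p\times n}$, and consider the system $x(t+1)=Ax(t)+Bu(t)$, $y(t)=Cx(t)$. Let $\mathcal{V}^*$ be the largest $(A,\operatorname{Im}(B))$-controlled invariant subspace contained in $\operatorname{Ker}(C)$, let $\mathcal{S}^*$ be the smallest $(A,\operatorname{Ker}(C))$-conditioned invariant subspace containing $\operatorname{Im}(B)$, and assume that $\mathcal{R}^*=\mathcal{V}^*\cap\mathcal{S}^*=\{0\}$. Let $x(0),\dots,x(T)$ be a state trajectory of the system with inputs $u(0),\dots,u(T-1)$, and set $$X_{0,T}=[x(1)\ \cdots\ x(T-1)],\quad X_{1,T}=[x(2)\ \cdots\ x(T)],\quad U_{0,T}=[u(1)\ \cdots\ u(T-1)],$$ and assume that $\begin{bmatrix}U_{0,T} \\ X_{0,T}\end{bmatrix}$ has full row rank. Let $V$ be a matrix whose columns form a basis of $\mathcal{V}^*$, let $K$ be a matrix whose columns form a basis of $\operatorname{Ker}(X_{0,T})$, and let $$\gamma=-\big((I-VV^\dagger)X_{1,T}K\big)^\dagger(I-VV^\dagger)X_{1,T}X_{0,T}^\dagger VV^\dagger,\qquad G=X_{0,T}^\dagger+K\gamma.$$ Let $P=[P_1\ \ P_2]\in\mathbb{R}^{n\times n}$ be nonsingular, where the columns of $P_1$ form a basis of $\mathcal{V}^*$. Then $$P^{-1}(X_{1,T}G)P=\begin{bmatrix}A_{11} & A_{12} \\ 0 & A_{22}\end{bmatrix}$$ with $A_{11}$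 of size $\dim\mathcal{V}^*\times\dim\mathcal{V}^*$, and the invariant zeros of the system $(A,B,C)$ are the eigenvalues of $A_{11}$.
   Context: $M^\dagger$ denotes the Moore–Penrose pseudoinverse of $M$. A subspace $\mathcal{V}\subseteq\mathbb{R}^n$ is $(A,\operatorname{Im}(B))$-controlled invariant if $A\mathcal{V}\subseteq\mathcal{V}+\operatorname{Im}(B)$. A subspace $\mathcal{S}\subseteq\mathbb{R}^n$ is $(A,\operatorname{Ker}(C))$-conditioned invariant if $A(\mathcal{S}\cap\operatorname{Ker}(C))\subseteq\mathcal{S}$. Invariant zeros: when $\mathcal{R}^*=\{0\}$, the invariant zeros of $(A,B,C)$ are the eigenvalues of the restriction of $A+BF$ to $\mathcal{V}^*$, where $F$ is any matrix with $(A+BF)\mathcal{V}^*\subseteq\mathcal{V}^*$ (they do not depend on the choice of $F$). *)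

(* Defs.v *)
From HB Require Import structures.
From mathcomp Require Import all_boot all_order all_algebra.
From mathcomp Require Import reals complex.

Set Implicit Arguments.
Unset Strict Implicit.
Unset Printing Implicit Defensive.

Import Order.TTheory GRing.Theory Num.Theory.
Local Open Scope ring_scope.

Section Pseudoinverse.
Variable R : realFieldType.

Definition penrose m n (M : 'M[R]_(m, n)) (X : 'M[R]_(n, m)) : bool :=
  [&& M *m X *m M == M, X *m M *m X == X,
      (M *m X)^T == M *m X & (X *m M)^T == X *m M].

Lemma gram_unitmx m n (L : 'M[R]_(m, n)) : row_free L -> L *m L^T \in unitmx.
Proof.
move=> Lfree; rewrite -row_free_unit -kermx_eq0.
apply/rowV0P => v /sub_kermxP vG0.
suff vL0 : v *m L = 0.
  by apply/eqP; rewrite -(mulmx_free_eq0 v Lfree) vL0.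
have N0 : (v *m L) *m (v *m L)^T = 0.
  by rewrite trmx_mul mulmxA -(mulmxA v) vG0 mul0mx.
apply/rowP => j; rewrite [RHS]mxE.
move/matrixP: N0 => /(_ 0 0); rewrite mxE [RHS]mxE => /eqP.
rewrite psumr_eq0; last by move=> i _; rewrite [_^T _ _]mxE -expr2 sqr_ge0.
move/allP => /(_ j (mem_index_enum _)); rewrite /= [_^T _ _]mxE -expr2.
by rewrite sqrf_eq0 => /eqP.
Qed.

Lemma penrose_exists m n (M : 'M[R]_(m, n)) : exists X, penrose M X.
Proof.
have [r [L [U [defM uU uL]]]] : exists r (L : 'M[R]_(m, r)) (U : 'M[R]_(r, n)),
    [/\ L *m U = M, U *m U^T \in unitmx & L^T *m L \in unitmx].
  exists (\rank M), (col_base M), (row_base M); split.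
  - exact: mulmx_base.
  - by apply: gram_unitmx; exact: row_base_free.
  - rewrite -{2}[col_base M]trmxK; apply: gram_unitmx.
    by rewrite /row_free mxrank_tr; exact: col_base_full.
pose Li := invmx (L^T *m L) *m L^T; pose Ui := U^T *m invmx (U *m U^T).
have LiL : Li *m L = 1%:M by rewrite /Li -mulmxA mulVmx.
have UUi : U *m Ui = 1%:M by rewrite /Ui mulmxA mulmxV.
have MX : M *m (Ui *m Li) = L *m Li.
  by rewrite -defM mulmxA -(mulmxA L) UUi mulmx1.
have XM : (Ui *m Li) *m M = Ui *m U.
  by rewrite -defM mulmxA -(mulmxA Ui) LiL mulmx1.
exists (Ui *m Li); rewrite /penrose MX XM; apply/and4P; split; apply/eqP.
- by rewrite -defM mulmxA -(mulmxA L) LiL mulmx1.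
- by rewrite mulmxA -(mulmxA Ui) UUi mulmx1.
- by rewrite /Li !trmx_mul trmxK trmx_inv trmx_mul trmxK mulmxA.
- by rewrite /Ui !trmx_mul trmxK trmx_inv trmx_mul trmxK mulmxA.
Qed.

Lemma penrose_unique m n (M : 'M[R]_(m, n)) X Y :
  penrose M X -> penrose M Y -> X = Y.
Proof.
case/and4P => /eqP MXM /eqP XMX /eqP sMX /eqP sXM.
case/and4P => /eqP MYM /eqP YMY /eqP sMY /eqP sYM.
have e1 : M *m X = M *m Y.
  have h : M *m X = (M *m Y) *m (M *m X) by rewrite mulmxA MYM.
  by rewrite -sMX h trmx_mul sMX sMY mulmxA MXM.
have e2 : X *m M = Y *m M.
  have h : X *m M = (X *m M) *m (Y *m M).
    by rewrite mulmxA -(mulmxA X) -mulmxA -mulmxA (mulmxA M) MYM.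
  by rewrite -sXM h trmx_mul sXM sYM -mulmxA (mulmxA M) MXM.
by rewrite -XMX -YMY e2 -!mulmxA e1.
Qed.

(* The Moore-Penrose pseudoinverse. The library's pinvmx is only a partial
   inverse on the row space. *)
Definition pinv m n (M : 'M[R]_(m, n)) : 'M[R]_(n, m) :=
  xchoose (penrose_exists M).

Lemma pinvP m n (M : 'M[R]_(m, n)) : penrose M (pinv M).
Proof. exact: xchooseP. Qed.

End Pseudoinverse.

Section Subspaces.
Variable R : fieldType.

(* Subspaces of R^n are vspaces of column vectors. *)
Definition image_mx m n (M : 'M[R]_(m, n)) (U : {vspace 'cV[R]_n}) :
  {vspace 'cV[R]_m} := (linfun (mulmx M : 'cV[R]_n -> 'cV[R]_m) @: U)%VS.

Definition Im_mx m n (M : 'M[R]_(m, n)) : {vspace 'cV[R]_m} :=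
  limg (linfun (mulmx M : 'cV[R]_n -> 'cV[R]_m)).

Definition Ker_mx m n (M : 'M[R]_(m, n)) : {vspace 'cV[R]_n} :=
  lker (linfun (mulmx M : 'cV[R]_n -> 'cV[R]_m)).

Definition cols_basis n k (W : 'M[R]_(n, k)) (U : {vspace 'cV[R]_n}) : bool :=
  basis_of U [seq col j W | j <- enum 'I_k].

Definition controlled_invariant n m (A : 'M[R]_n) (B : 'M[R]_(n, m))
  (V : {vspace 'cV[R]_n}) : bool := (image_mx A V <= V + Im_mx B)%VS.

Definition conditioned_invariant n p (A : 'M[R]_n) (C : 'M[R]_(p, n))
  (S : {vspace 'cV[R]_n}) : bool := (image_mx A (S :&: Ker_mx C) <= S)%VS.

Definition is_Vstar n m p (A : 'M[R]_n) (B : 'M[R]_(n, m)) (C : 'M[R]_(p, n))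
    (V : {vspace 'cV[R]_n}) : Prop :=
  [/\ controlled_invariant A B V, (V <= Ker_mx C)%VS &
      forall W : {vspace 'cV[R]_n},
        controlled_invariant A B W -> (W <= Ker_mx C)%VS -> (W <= V)%VS].

Definition is_Sstar n m p (A : 'M[R]_n) (B : 'M[R]_(n, m)) (C : 'M[R]_(p, n))
    (S : {vspace 'cV[R]_n}) : Prop :=
  [/\ conditioned_invariant A C S, (Im_mx B <= S)%VS &
      forall W : {vspace 'cV[R]_n},
        conditioned_invariant A C W -> (Im_mx B <= W)%VS -> (S <= W)%VS].

(* For an M-invariant U: the matrix of the restriction of M to U in the basis
   vbasis U, acting on coordinate columns. *)
Definition restr_mx n (M : 'M[R]_n) (U : {vspace 'cV[R]_n}) : 'M[R]_(\dim U) :=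
  \matrix_(i, j) coord (vbasis U) i (M *m (vbasis U)`_j).

(* The columns are w(s), ..., w(s + N - 1). *)
Definition window q (w : nat -> 'cV[R]_q) (s N : nat) : 'M[R]_(q, N) :=
  \matrix_(i, j) w (s + j)%N i 0.

End Subspaces.

Section InvariantZeros.
Variable R : realType.
Local Open Scope complex_scope.

(* z is a complex eigenvalue of the real matrix M, of algebraic multiplicity d. *)
Definition is_eigenvalue_mult k (M : 'M[R]_k) (z : R[i]) (d : nat) : Prop :=
  let MC := map_mx (real_complex R) M in
  eigenvalue MC z /\ mup z (char_poly MC) = d.

(* z is an invariant zero of (A, B, C), with multiplicity d. This is the notion
   for systems with R* = 0, where the choice of F does not matter; V* is
   unique, so quantifying over V only names it. *)
Definition is_invariant_zero n m p (A : 'M[R]_n) (B : 'M[R]_(n, m))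
    (C : 'M[R]_(p, n)) (z : R[i]) (d : nat) : Prop :=
  exists (V : {vspace 'cV[R]_n}) (F : 'M[R]_(m, n)),
    [/\ is_Vstar A B C V, (image_mx (A + B *m F) V <= V)%VS &
        is_eigenvalue_mult (restr_mx (A + B *m F) V) z d].

End InvariantZeros.

(* Main.v *)
Require Import Defs.
From HB Require Import structures.
From mathcomp Require Import all_boot all_order all_algebra.
From mathcomp Require Import reals complex.

Set Implicit Arguments.
Unset Strict Implicit.
Unset Printing Implicit Defensive.

Import Order.TTheory GRing.Theory Num.Theory.
Local Open Scope ring_scope.

(** Since X1 = A X0 + B U0 and X0 G = 1, the data matrix X1 G is the closed loop
    A + B F with F = U0 G. Full row rank of [U0; X0] makes U0 surjective on
    Ker X0 = Im K, so Q X1 K has the same image as Q B, where Q = 1 - V V^+;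
    controlled invariance of V* then places the columns of Q X1 X0^+ V in that
    image, and the pseudoinverse in gamma cancels them exactly. Hence F is a
    friend of V*. Two friends of V* give the same restriction, because their
    difference maps V* into V* /\ Im B, which is contained in R* = 0. *)

(** * Similarity and block-triangular form *)

Lemma char_poly_similar (F : idomainType) n (M N S : 'M[F]_n) :
  \det S != 0 -> M *m S = S *m N -> char_poly M = char_poly N.
Proof.
move=> detS MS; pose S' := map_mx polyC S.
have detS' : \det S' != 0 by rewrite det_map_mx polyC_eq0.
have : char_poly_mx M *m S' = S' *m char_poly_mx N.
  by rewrite /char_poly_mx mulmxBl mulmxBr scalar_mxC -!map_mxM MS.
move/(congr1 determinant); rewrite !det_mulmx mulrC.
exact: mulfI.
Qed.

(** Eigenvalue and multiplicity are both read off the characteristic polynomial, which commutes with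
    the embedding of [R] into [R[i]], so a real similarity suffices. *)
Lemma eigenvalue_mult_similar (R : realType) k (M N S : 'M[R]_k) z d :
    S \in unitmx -> M *m S = S *m N ->
  is_eigenvalue_mult M z d <-> is_eigenvalue_mult N z d.
Proof.
rewrite unitmxE unitfE => detS MS.
rewrite /is_eigenvalue_mult /= !eigenvalue_root_char -!map_char_poly.
by rewrite (char_poly_similar detS MS).
Qed.

(** Since [invmx P *m P1] is the identity stacked on zero, the first block column of the conjugate
    is [N] stacked on zero. *)
Lemma invmx_block_triangular (F : fieldType) n r q (hn : (r + q = n)%N)
    (M : 'M[F]_n) (P1 : 'M[F]_(n, r)) (P2 : 'M[F]_(n, q)) (N : 'M[F]_r) :
  let P := castmx (erefl n, hn) (row_mx P1 P2) in
  P \in unitmx -> M *m P1 = P1 *m N ->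
  exists A12 A22,
    invmx P *m M *m P = castmx (hn, hn) (block_mx N A12 0 A22).
Proof.
move: M P1 P2; case: n / hn => M P1 P2; rewrite /= !castmx_id.
set P := row_mx P1 P2 => uP MP1.
have iPP1 : invmx P *m P1 = col_mx 1%:M 0.
  have : invmx P *m P = 1%:M by rewrite mulVmx.
  by rewrite {2}/P mul_mx_row scalar_mx_block block_mxEh => /eq_row_mx [].
pose D := invmx P *m M *m P2.
exists (usubmx D), (dsubmx D).
rewrite castmx_id {2}/P mul_mx_row -/D -mulmxA MP1 mulmxA iPP1.
by rewrite mul_col_mx mul1mx mul0mx block_mxEh vsubmxK.
Qed.

(** * Bases as matrices of columns, restrictions as intertwining relations *)

Section ColumnSubspaces.
Variable F : fieldType.

Lemma mem_image_mx m n (M : 'M[F]_(m, n)) (U : {vspace 'cV[F]_n}) w :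
  reflect (exists2 v, v \in U & w = M *m v) (w \in image_mx M U).
Proof.
by apply: (iffP memv_imgP) => -[v vU ->]; exists v; rewrite ?lfunE.
Qed.

Lemma mem_Im_mx m n (M : 'M[F]_(m, n)) w :
  reflect (exists v, w = M *m v) (w \in Im_mx M).
Proof.
apply: (iffP memv_imgP) => [[v _ ->]|[v ->]]; exists v; rewrite ?lfunE //.
exact: memvf.
Qed.

Lemma mem_Ker_mx m n (M : 'M[F]_(m, n)) v :
  (v \in Ker_mx M) = (M *m v == 0).
Proof. by rewrite memv_ker lfunE. Qed.

(** With [N = 1] this also yields the coordinates of a single vector of [U]. *)
Lemma cols_in_factor n k N (W : 'M[F]_(n, k)) (U : {vspace 'cV[F]_n})
    (M : 'M[F]_(n, N)) :
  cols_basis W U -> (forall j, col j M \in U) -> exists Z, M = W *m Z.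
Proof.
move=> WU MU; pose X := [tuple col j W | j < k].
exists (\matrix_(i, j) coord X i (col j M)).
apply/matrixP => i j; have := MU j.
rewrite -(span_basis WU) => /(coord_span (X := X)) /colP/(_ i).
rewrite mxE summxE mxE => ->; apply: eq_bigr => a _.
by rewrite -tnth_nth tnth_mktuple !mxE mulrC.
Qed.

Lemma cols_basis_mem n k (W : 'M[F]_(n, k)) (U : {vspace 'cV[F]_n}) j :
  cols_basis W U -> col j W \in U.
Proof.
move=> WU; apply: (basis_mem WU); apply: map_f; exact: mem_enum.
Qed.

Lemma cols_basis_mulmx n k (W : 'M[F]_(n, k)) (U : {vspace 'cV[F]_n}) v :
  cols_basis W U -> W *m v \in U.
Proof.
move=> WU; have -> : W *m v = \sum_j v j 0 *: col j W.
  apply/colP => i; rewrite mxE summxE; apply: eq_bigr => j _.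
  by rewrite !mxE mulrC.
by apply: memv_suml => j _; apply/memvZ/cols_basis_mem.
Qed.

Lemma cols_basis_inj n k N (W : 'M[F]_(n, k)) (U : {vspace 'cV[F]_n}) :
  cols_basis W U -> injective (fun Z : 'M[F]_(k, N) => W *m Z).
Proof.
move=> WU Z Z' /eqP; rewrite -subr_eq0 -mulmxBr => /eqP WZ.
apply/eqP; rewrite -subr_eq0; apply/eqP/matrixP => i j; rewrite [RHS]mxE.
move: (Z - Z') WZ => {Z'}Z WZ; pose X := [tuple col j W | j < k].
have /freeP freeX : free X by exact: basis_free WU.
apply: (freeX (fun i => Z i j)).
apply/colP => a; rewrite summxE.
move/matrixP: WZ => /(_ a j); rewrite !mxE => {2}<-.
by apply: eq_bigr => b _; rewrite -tnth_nth tnth_mktuple !mxE mulrC.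
Qed.

Lemma cols_basis_change n k (W W' : 'M[F]_(n, k)) (U : {vspace 'cV[F]_n}) :
  cols_basis W U -> cols_basis W' U -> exists2 S, S \in unitmx & W' = W *m S.
Proof.
move=> WU W'U.
have [j|S defW'] := cols_in_factor WU (M := W'); first exact: cols_basis_mem.
have [j|S' defW] := cols_in_factor W'U (M := W); first exact: cols_basis_mem.
exists S => //; suff /mulmx1_unit[] : S *m S' = 1%:M by [].
by apply: (cols_basis_inj WU); rewrite mulmxA -defW' -defW mulmx1.
Qed.

Definition vbasis_mx n (U : {vspace 'cV[F]_n}) : 'M[F]_(n, \dim U) :=
  \matrix_(i, j) (vbasis U)`_j i 0.

Lemma col_vbasis_mx n (U : {vspace 'cV[F]_n}) j :
  col j (vbasis_mx U) = (vbasis U)`_j.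
Proof. by apply/colP => i; rewrite !mxE. Qed.

Lemma cols_basis_vbasis_mx n (U : {vspace 'cV[F]_n}) :
  cols_basis (vbasis_mx U) U.
Proof.
rewrite /cols_basis (_ : map _ _ = vbasis U) ?vbasisP //.
apply: (@eq_from_nth _ 0) => [|i]; rewrite size_map size_enum_ord ?size_tuple //.
move=> ltid; pose j := Ordinal ltid.
by rewrite (nth_map j) ?size_enum_ord // col_vbasis_mx nth_enum_ord.
Qed.

(** [coord] recovers a vector only inside [U], hence the invariance hypothesis. *)
Lemma mulmx_vbasis_mx n (M : 'M[F]_n) (U : {vspace 'cV[F]_n}) :
  (image_mx M U <= U)%VS -> M *m vbasis_mx U = vbasis_mx U *m restr_mx M U.
Proof.
move=> MU; apply/matrixP => i j.
have vjU : M *m (vbasis U)`_j \in U.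
  apply: (subvP MU); apply/mem_image_mx; exists (vbasis U)`_j => //.
  by apply: vbasis_mem; rewrite mem_nth ?size_tuple.
transitivity ((M *m (vbasis U)`_j) i 0).
  by rewrite -col_vbasis_mx [in RHS]colE mulmxA -colE [RHS]mxE.
rewrite {1}(coord_vbasis vjU) summxE mxE.
by apply: eq_bigr => a _; rewrite !mxE mulrC.
Qed.

Lemma image_mx_sub_cols n k (M : 'M[F]_n) (U : {vspace 'cV[F]_n})
    (W : 'M[F]_(n, k)) (N : 'M[F]_k) :
  cols_basis W U -> M *m W = W *m N -> (image_mx M U <= U)%VS.
Proof.
move=> WU MW; apply/subvP => w /mem_image_mx[v vU ->].
have [j|c ->] := cols_in_factor WU (M := v); first by rewrite col_id.
by rewrite mulmxA MW -mulmxA; exact: cols_basis_mulmx.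
Qed.

(** With [W = vbasis_mx U *m S], both sides agree after left multiplication by [vbasis_mx U], which
    is injective. *)
Lemma restr_mx_similar n (M : 'M[F]_n) (U : {vspace 'cV[F]_n})
    (W : 'M[F]_(n, \dim U)) (N : 'M[F]_(\dim U)) :
  cols_basis W U -> M *m W = W *m N ->
  exists2 S, S \in unitmx & restr_mx M U *m S = S *m N.
Proof.
move=> WU MW; have BU := cols_basis_vbasis_mx U.
have [S uS defW] := cols_basis_change BU WU.
exists S => //; apply: (cols_basis_inj BU).
rewrite mulmxA -mulmx_vbasis_mx ?(image_mx_sub_cols WU MW) //.
by rewrite -mulmxA -defW MW {1}defW mulmxA.
Qed.

End ColumnSubspaces.

Lemma restr_mx_eigenvalue_mult (R : realType) (n r : nat)
    (M : 'M[R]_n) (U : {vspace 'cV[R]_n}) (hr : \dim U = r)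
    (W : 'M[R]_(n, r)) (N : 'M[R]_r) z d :
  cols_basis W U -> M *m W = W *m N ->
  is_eigenvalue_mult (restr_mx M U) z d <-> is_eigenvalue_mult N z d.
Proof.
move: W N; case: r / hr => W N WU MW.
have [S uS eS] := restr_mx_similar WU MW.
exact: eigenvalue_mult_similar uS eS.
Qed.

(** * The system: its largest subspace, its data equation and its friends *)

Lemma is_Vstar_unique (R : fieldType) n m p (A : 'M[R]_n) (B : 'M[R]_(n, m))
    (C : 'M[R]_(p, n)) (V W : {vspace 'cV[R]_n}) :
  is_Vstar A B C V -> is_Vstar A B C W -> V = W.
Proof.
move=> [cV kV mV] [cW kW mW]; apply/eqP.
by rewrite eqEsubv mW // mV.
Qed.

Lemma window_step (R : fieldType) n m (A : 'M[R]_n) (B : 'M[R]_(n, m))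
    (x : nat -> 'cV[R]_n) (u : nat -> 'cV[R]_m) s N :
    (forall j, (j < N)%N ->
       x (s + j).+1 = A *m x (s + j)%N + B *m u (s + j)%N) ->
  window x s.+1 N = A *m window x s N + B *m window u s N.
Proof.
move=> hx; apply/matrixP => i j.
rewrite mxE addSn hx // !mxE.
by congr (_ + _); apply: eq_bigr => a _; rewrite !mxE.
Qed.

(* The two closed loops differ on [U] by [B *m (F - F')], whose values lie in
   [U :&: Im_mx B]. *)
Lemma friends_agree (R : fieldType) n m k (A : 'M[R]_n) (B : 'M[R]_(n, m))
    (U : {vspace 'cV[R]_n}) (F F' : 'M[R]_(m, n)) (W : 'M[R]_(n, k)) :
    (U :&: Im_mx B = 0)%VS -> cols_basis W U ->
    (image_mx (A + B *m F) U <= U)%VS -> (image_mx (A + B *m F') U <= U)%VS ->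
  (A + B *m F) *m W = (A + B *m F') *m W.
Proof.
move=> UB0 WU FU F'U; apply/eqP; rewrite -subr_eq0 -mulmxBl; apply/eqP.
apply/matrixP => i j; rewrite [RHS]mxE.
suff /eqP/colP/(_ i) : col j ((A + B *m F - (A + B *m F')) *m W) == 0.
  by rewrite !mxE.
rewrite -memv0 -UB0 memv_cap colE -mulmxA -colE; apply/andP; split.
  rewrite mulmxBl; apply: memvB; [apply: (subvP FU)|apply: (subvP F'U)];
  by apply/mem_image_mx; exists (col j W) => //; exact: cols_basis_mem.
apply/mem_Im_mx; exists ((F - F') *m col j W).
by rewrite mulmxA mulmxBr opprD addrACA subrr add0r.
Qed.

(** * Pseudoinverse and the feedback computed from data *)

Lemma mulmx_pinvK (R : realFieldType) m n (M : 'M[R]_(m, n)) :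
  M *m pinv M *m M = M.
Proof. by case/and4P: (pinvP M) => /eqP. Qed.

Lemma row_free_pinv (R : realFieldType) m n (M : 'M[R]_(m, n)) :
  row_free M -> M *m pinv M = 1%:M.
Proof.
by case/row_freeP => Y MY; rewrite -[LHS]mulmx1 -MY mulmxA mulmx_pinvK.
Qed.

Lemma controlled_invariant_cols (R : fieldType) n m k (A : 'M[R]_n)
    (B : 'M[R]_(n, m)) (U : {vspace 'cV[R]_n}) (W : 'M[R]_(n, k)) :
  controlled_invariant A B U -> cols_basis W U ->
  exists N L, A *m W = W *m N + B *m L.
Proof.
move=> /subvP cU WU.
(* Stated with the boolean equality so that [xchoose] can select one decomposition per column. *)
have dec j : exists c : 'cV_k * 'cV_m, A *m col j W == W *m c.1 + B *m c.2.
  have /cU /memv_addP[v vU [w /mem_Im_mx[b ->] ->]] :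
      A *m col j W \in image_mx A U.
    by apply/mem_image_mx; exists (col j W) => //; exact: cols_basis_mem.
  have [a|c ->] := cols_in_factor WU (M := v); first by rewrite col_id.
  by exists (c, b).
pose c j := xchoose (dec j).
exists (\matrix_(i, j) (c j).1 i 0), (\matrix_(i, j) (c j).2 i 0).
apply/matrixP => i j; have /eqP/colP/(_ i) := xchooseP (dec j).
rewrite !mxE -/(c j) => /esym e.
transitivity (\sum_a A i a * (col j W) a 0).
  by apply: eq_bigr => a _; rewrite mxE.
by rewrite -e; congr (_ + _); apply: eq_bigr => a _; rewrite !mxE.
Qed.

(** For [M = Q *m X1 *m K], the product [M *m pinv M] fixes the image of [M], where the hypothesis
    places the part to be cancelled. A matrix killed by [Q] has its columns in the image of [V]. *)
Lemma data_feedback_invariant (R : realFieldType) n N r l (X1 : 'M[R]_(n, N))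
    (Y : 'M[R]_(N, n)) (K : 'M[R]_(N, l)) (V : 'M[R]_(n, r))
    (H : 'M[R]_(l, r)) :
  let Q := 1%:M - V *m pinv V in
  let gamma := - (pinv (Q *m X1 *m K) *m Q *m X1 *m Y *m V *m pinv V) in
  Q *m X1 *m Y *m V = Q *m X1 *m K *m H ->
  exists Z, X1 *m (Y + K *m gamma) *m V = V *m Z.
Proof.
move=> Q gamma eH.
suff : Q *m (X1 *m (Y + K *m gamma) *m V) = 0.
  move/eqP; rewrite mulmxBl mul1mx subr_eq0 => /eqP e.
  by exists (pinv V *m (X1 *m (Y + K *m gamma) *m V)); rewrite mulmxA.
(* The trailing [V *m pinv V] of [gamma] is absorbed by [V]. *)
have gV : gamma *m V = - (pinv (Q *m X1 *m K) *m (Q *m X1 *m K *m H)).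
  by rewrite mulNmx -eH -!mulmxA (mulmxA V) mulmx_pinvK.
have -> : Q *m (X1 *m (Y + K *m gamma) *m V) =
    Q *m X1 *m Y *m V + Q *m X1 *m K *m (gamma *m V).
  by rewrite mulmxDr mulmxDl mulmxDr !mulmxA.
rewrite gV eH; move: (Q *m X1 *m K) => M.
by rewrite mulmxN !mulmxA mulmx_pinvK subrr.
Qed.

Theorem mainTheorem8 (R : realType) (n m p : nat)
    (A : 'M[R]_n) (B : 'M[R]_(n, m)) (C : 'M[R]_(p, n))
    (Vs Ss : {vspace 'cV[R]_n})
    (hVs : is_Vstar A B C Vs) (hSs : is_Sstar A B C Ss)
    (hRs : (Vs :&: Ss = 0)%VS)
    (T : nat) (x : nat -> 'cV[R]_n) (u : nat -> 'cV[R]_m)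
    (hx : forall t : nat, (t < T)%N -> x t.+1 = A *m x t + B *m u t) :
  let X0 : 'M[R]_(n, T.-1) := window x 1 T.-1 in
  let X1 : 'M[R]_(n, T.-1) := window x 2 T.-1 in
  let U0 : 'M[R]_(m, T.-1) := window u 1 T.-1 in
  forall (hrank : row_free (col_mx U0 X0))
    (r : nat) (hr : \dim Vs = r)
    (V : 'M[R]_(n, r)) (hV : cols_basis V Vs)
    (l : nat) (K : 'M[R]_(T.-1, l)) (hK : cols_basis K (Ker_mx X0)),
  let Q : 'M[R]_n := 1%:M - V *m pinv V in
  let gamma : 'M[R]_(l, n) :=
    - (pinv (Q *m X1 *m K) *m Q *m X1 *m pinv X0 *m V *m pinv V) in
  let G : 'M[R]_(T.-1, n) := pinv X0 + K *m gamma in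
  forall (q : nat) (hn : (r + q = n)%N)
    (P1 : 'M[R]_(n, r)) (P2 : 'M[R]_(n, q)),
  let P : 'M[R]_n := castmx (erefl n, hn) (row_mx P1 P2) in
  forall (hP : P \in unitmx) (hP1 : cols_basis P1 Vs),
  exists (A11 : 'M[R]_r) (A12 : 'M[R]_(r, q)) (A22 : 'M[R]_q),
    invmx P *m (X1 *m G) *m P = castmx (hn, hn) (block_mx A11 A12 0 A22) /\
    (forall (z : complex R) (d : nat),
       is_invariant_zero A B C z d <-> is_eigenvalue_mult A11 z d).
Proof.
move=> X0 X1 U0 hrank r hr V hV l K hK Q gamma G q hn P1 P2 P hP hP1.
(* The windows start at time 1, so [j < T.-1] is exactly what puts time [1 + j] below [T]. *)
have X1E : X1 = A *m X0 + B *m U0.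
  by apply: window_step => j ltj; apply: hx; rewrite add1n -ltn_predRL.
(* A right inverse of the stacked data splits into [Yu], with [U0 *m Yu = 1] and [X0 *m Yu = 0], and
   [Yx], with [X0 *m Yx = 1]. *)
have [Y] := row_freeP hrank; rewrite mul_col_mx scalar_mx_block.
rewrite -[Y]hsubmxK !mul_mx_row => /eq_col_mx[/eq_row_mx[U0Y _]].
case/eq_row_mx=> X0Y X0Y'; move: (lsubmx Y) (rsubmx Y) U0Y X0Y X0Y' => Yu Yx.
move=> U0Yu X0Yu X0Yx.
have X0G : X0 *m pinv X0 = 1%:M.
  by apply/row_free_pinv/row_freeP; exists Yx.
have X0K : X0 *m K = 0.
  apply/matrixP => i j; rewrite [RHS]mxE.
  have := cols_basis_mem j hK; rewrite mem_Ker_mx => /eqP/colP/(_ i).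
  by rewrite colE mulmxA -colE !mxE.
have X1G : X1 *m G = A + B *m (U0 *m G).
  rewrite X1E mulmxDl !mulmxA -(mulmxA A) mulmxDr X0G mulmxA X0K.
  by rewrite mul0mx addr0 mulmx1.
(* [Yu] lies in the kernel of [X0], so it factors as [K *m H]; then [X1 *m K *m H = B], which puts
   the image of [B] inside that of [X1 *m K]. *)
have [j|H defYu] := cols_in_factor hK (M := Yu).
  by rewrite mem_Ker_mx colE mulmxA X0Yu mul0mx.
have [cVs _ _] := hVs.
have [N [L AV]] := controlled_invariant_cols cVs hV.
have QV : Q *m V = 0 by rewrite mulmxBl mul1mx mulmx_pinvK subrr.
have [Z X1GV] : exists Z, X1 *m G *m V = V *m Z.
  (* Modulo the image of [V], [X1 *m pinv X0 *m V] equals [B] times [L + U0 *m pinv X0 *m V]; the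
     factor [H] converts [B] into [X1 *m K]. *)
  apply: (data_feedback_invariant (H := H *m (L + U0 *m pinv X0 *m V))).
  have X1Yu : X1 *m (K *m H) = B.
    by rewrite -defYu X1E mulmxDl -!mulmxA X0Yu U0Yu mulmx0 mulmx1 add0r.
  have X1V : X1 *m (pinv X0 *m V) = V *m N + B *m (L + U0 *m pinv X0 *m V).
    rewrite X1E mulmxDl -!mulmxA (mulmxA X0) X0G mul1mx AV mulmxDr addrA.
    by rewrite !mulmxA.
  transitivity (Q *m (X1 *m (pinv X0 *m V))); first by rewrite !mulmxA.
  by rewrite X1V mulmxDr mulmxA QV mul0mx add0r -{1}X1Yu !mulmxA.
have inv : (image_mx (X1 *m G) Vs <= Vs)%VS := image_mx_sub_cols hV X1GV.
have [j|A11 MP1] := cols_in_factor hP1 (M := X1 *m G *m P1).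
  apply: (subvP inv); apply/mem_image_mx; exists (col j P1).
    exact: cols_basis_mem.
  by rewrite [in RHS]colE mulmxA -colE.
have [A12 [A22 blk]] := invmx_block_triangular hP MP1.
exists A11, A12, A22; split=> // z d.
have VB0 : (Vs :&: Im_mx B = 0)%VS.
  have [_ BS _] := hSs.
  by apply/eqP; rewrite -subv0 -hRs capvS.
(* Any friend acts on [P1] as the data closed loop [X1 *m G] does, hence through the same [A11]. *)
have friend F : (image_mx (A + B *m F) Vs <= Vs)%VS ->
    is_eigenvalue_mult (restr_mx (A + B *m F) Vs) z d <->
    is_eigenvalue_mult A11 z d.
  move=> FV; have FP1 : (A + B *m F) *m P1 = P1 *m A11.
    by rewrite -MP1 X1G; apply: (friends_agree VB0); rewrite -?X1G.
  exact: (restr_mx_eigenvalue_mult _ _ _ hP1 FP1).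
split=> [[U [F [hU]]]|].
  by rewrite (is_Vstar_unique hU hVs) => FU /(friend _ FU).
(* Conversely, [U0 *m G] is itself a friend and witnesses the invariant zero. *)
rewrite X1G in inv; move/(friend _ inv) => eig.
by exists Vs, (U0 *m G).
Qed.
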